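(* Let $m$ be an odd integer with $m \not\equiv 2 \pmod 3$ such that $D = 9m^2+4m$ is square-free, and let $K = \mathbb{Q}(\sqrt{D})$ with class number $h_K$. Then $h_K = 1$ if and only if $m \in \{-3, 1, 3\}$.
   Context: For every odd integer $m$ (positive or negative), $D = 9m^2+4m > 0$, so $K=\mathbb{Q}(\sqrt{D})$ is a real quadratic field; $h_K$ denotes the order of its (ordinary) ideal class group. *)

(* Defs.v *)
From HB Require Import structures.
From mathcomp Require Import all_boot all_order all_algebra all_field.
From mathcomp Require Import finmap.
From mathcomp Require Import boolp classical_sets functions cardinality.

Set Implicit Arguments.
Unset Strict Implicit.
Unset Printing Implicit Defensive.

Import Order.TTheory GRing.Theory Num.Theory.
Local Open Scope classical_set_scope.
Local Open Scope ring_scope.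

Definition squarefree_int (n : int) : Prop :=
  forall d : int, (d ^+ 2 %| n)%Z -> `|d|%N = 1%N.

(* K = Q(sqrt D), up to isomorphism.  A [fieldExtType rat] is a number field. *)
Definition is_quadratic_field (K : fieldExtType rat) (D : int) : Prop :=
  exists2 s : K, s ^+ 2 = D%:~R & <<1%VS; s>>%VS = fullv.

Section ClassGroup.
Variable K : fieldExtType rat.

Definition ring_of_integers : set K :=
  [set x | integralOver (intr : int -> K) x].

(* Nonzero fractional ideals: nonzero O_K-submodules I of K admitting a common
   denominator d in O_K. *)
Definition fractional_ideal (I : set K) : Prop :=
  [/\ I 0,
      forall x y, I x -> I y -> I (x + y),
      forall a x, ring_of_integers a -> I x -> I (a * x),
      exists2 x, I x & x != 0
    & exists d, [/\ ring_of_integers d, d != 0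
                  & forall x, I x -> ring_of_integers (d * x)]].

Definition principal_ideal (a : K) : set K :=
  [set a * x | x in ring_of_integers].

Definition ideal_mul (I J : set K) : set K :=
  [set z | exists n (x y : 'I_n -> K),
     [/\ forall i, I (x i), forall i, J (y i) & z = \sum_(i < n) x i * y i]].

(* The coset of I modulo the subgroup of principal fractional ideals. *)
Definition ideal_class (I : set K) : set (set K) :=
  [set ideal_mul I (principal_ideal a) | a in [set a : K | a != 0]].

(* Underlying set of the quotient of the group of fractional ideals by the
   subgroup of principal ones. *)
Definition class_group : set (set (set K)) :=
  [set ideal_class I | I in fractional_ideal].

(* [fset_set] of an infinite set is empty, so [class_number = 1] does entail
   that the class group has exactly one element. *)
Definition class_number : nat := #|` fset_set class_group|%fset.

End ClassGroup.

Arguments ring_of_integers : clear implicits.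
Arguments class_group : clear implicits.

(* Main.v *)
Require Import Defs.
From mathcomp Require Import all_boot all_order all_algebra all_field.
From mathcomp Require Import finmap ring lra zify.
From mathcomp Require Import boolp classical_sets functions cardinality.

Set Implicit Arguments.
Unset Strict Implicit.
Unset Printing Implicit Defensive.

Import Order.TTheory GRing.Theory Num.Theory.
Local Open Scope ring_scope.

(* If every ideal is principal, so is a prime ideal (3, r + sqrt D), which exists because 3 is
   not inert when m is not 2 mod 3; a generator yields a solution of u^2 - D v^2 = 12 or -12.
   Descent along the small unit (|9m + 2| + 3 sqrt D) / 2 makes such a solution impossible
   unless |9m + 2| <= 29, which leaves m = -3, 1, 3.
   Conversely, for D = 69, 13, 93 ideals are principal by the Dedekind-Hasse criterion. For g
   in K, Dirichlet approximation gives n <= 4 such that n g differs from an algebraic integer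
   by an element of norm < 1. If that difference vanishes, g has denominator n and one uses
   that 2 is inert and that the prime above the ramified 3 is principal (n = 1 if D = 13). *)

(** * Class number one as principality of all fractional ideals *)

Section ClassNumberOne.
Variable K : fieldExtType rat.
Local Notation O := (ring_of_integers K).

Lemma ring_of_integersZ (n : int) : O n%:~R.
Proof. exact: (integral_id (intmul 1 : {rmorphism int -> K})). Qed.

Lemma ring_of_integers1 : O 1.
Proof. exact: (ring_of_integersZ 1). Qed.

Lemma ring_of_integersD (x y : K) : O x -> O y -> O (x + y).
Proof. exact: (@integral_add _ _ (intmul 1 : {rmorphism int -> K})). Qed.

Lemma ring_of_integersB (x y : K) : O x -> O y -> O (x - y).
Proof. exact: (@integral_sub _ _ (intmul 1 : {rmorphism int -> K})). Qed.

Lemma ring_of_integersM (x y : K) : O x -> O y -> O (x * y).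
Proof. exact: (@integral_mul _ _ (intmul 1 : {rmorphism int -> K})). Qed.

Lemma fractional_ideal_ring_of_integers : fractional_ideal O.
Proof.
split; first exact: (ring_of_integersZ 0).
- exact: ring_of_integersD.
- exact: ring_of_integersM.
- by exists 1; [exact: ring_of_integers1 | exact: oner_neq0].
- exists 1; split; [exact: ring_of_integers1 | exact: oner_neq0 |].
  by move=> x; rewrite mul1r.
Qed.

(** The common factor [a] comes out of every finite sum of products, and what remains lies in [I]
    because [I] is an [O]-module. *)
Lemma ideal_mul_principal (I : set K) (a z : K) : fractional_ideal I ->
  ideal_mul I (principal_ideal a) z <-> exists2 x, I x & z = a * x.
Proof.
case=> I0 ID IM _ _; split=> [[n] [x] [y] [Ix ay ->]|[x Ix ->]].
- pose c i := projT1 (cid2 (ay i)).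
  have cP i : O (c i) /\ a * c i = y i by rewrite /c; case: cid2.
  exists (\sum_(i < n) c i * x i).
  + by elim/big_ind: _ => // i _; apply: IM => //; case: (cP i).
  + by rewrite mulr_sumr; apply: eq_bigr => i _; case: (cP i) => _ <-; ring.
- exists 1%N, (fun=> x), (fun=> a); split=> //; last by rewrite big_ord1 mulrC.
  by move=> _; exists 1; [exact: ring_of_integers1 | rewrite mulr1].
Qed.

(** Each [I] lies in its own class, and the class of [O] consists of the nonzero principal ideals.
    So a single class makes every [I] principal; conversely, [I = aO] has the class of [O], by
    rescaling generators by [a]. *)
Lemma class_number_eq1 : class_number K = 1%N <->
  forall I : set K, fractional_ideal I -> exists2 a, a != 0 & I = principal_ideal a.
Proof.
have clO (I : set K) : fractional_ideal I -> ideal_class I I.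
  move=> FI; exists 1; first exact: oner_neq0.
  apply/seteqP; split=> z.
    by move/(ideal_mul_principal _ _ FI) => [x Ix ->]; rewrite mul1r.
  by move=> Iz; apply/(ideal_mul_principal _ _ FI); exists z; rewrite ?mul1r.
have FO := fractional_ideal_ring_of_integers.
have clOE a : ideal_mul O (principal_ideal a) = principal_ideal a.
  apply/seteqP; split=> z.
    by move/(ideal_mul_principal _ _ FO) => [x Ox ->]; exists x.
  by case=> x Ox <-; apply/(ideal_mul_principal _ _ FO); exists x.
split=> [h1 I FI|PI].
- have [C Ceq] : exists C, class_group K = [set C]%classic.
    move: h1; rewrite /class_number => h1.
    (* For an infinite set [fset_set] takes its default value, the empty set, whose cardinal is not
       1. *)
    have fin : finite_set (class_group K).
      apply: contrapT => nfin; move: h1.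
      by rewrite /fset_set; case: pselect.
    move/eqP/cardfs1P: h1 => [C CE]; exists C.
    by rewrite -(fset_setK fin) CE set_fset1.
  have IC : ideal_class I = ideal_class O.
    have : class_group K (ideal_class I) by exists I.
    have : class_group K (ideal_class O) by exists O.
    by rewrite Ceq /= => -> ->.
  have : ideal_class O I by rewrite -IC; exact: clO.
  by case=> a /= a0 <-; exists a.
- suff clE : class_group K = [set ideal_class O]%classic.
    by rewrite /class_number clE fset_set1 cardfs1.
  apply/seteqP; split=> C /=; last by move=> ->; exists O.
  case=> I FI <-; have [a a0 IE] := PI I FI.
  apply/seteqP; split=> J [b /= b0 <-].
  + exists (a * b); first by rewrite /= mulf_neq0.
    rewrite clOE; apply/seteqP; split=> z.
      case=> x Ox <-; apply/(ideal_mul_principal _ _ FI); exists (a * x).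
        by rewrite IE; exists x.
      by ring.
    move/(ideal_mul_principal _ _ FI) => [x]; rewrite IE => -[y Oy <-] ->.
    by exists y => //; ring.
  + exists (b / a); first by rewrite /= mulf_neq0 ?invr_eq0.
    rewrite clOE; apply/seteqP; split=> z.
      move/(ideal_mul_principal _ _ FI) => [x]; rewrite IE => -[y Oy <-] ->.
      by exists y => //; field.
    case=> x Ox <-; apply/(ideal_mul_principal _ _ FI); exists (a * x).
      by rewrite IE; exists x.
    by field.
Qed.

End ClassNumberOne.

(** * Descent for norm equations along a small unit *)

(** Put t = 2e + 1 and D = 2d + 1. Since t^2 = 9D + 4, (t + 3 sqrt D)/2 is a unit of norm 1.
    Multiplying a solution by its inverse shrinks |v| unless 3u is far from tv, and that case bounds
    t. *)
Lemma pell_small_norm (d e u v : int) : 0 <= e -> 0 <= d ->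
  (2 * e + 1) ^+ 2 = 9 * (2 * d + 1) + 4 ->
  u ^+ 2 - (2 * d + 1) * v ^+ 2 = 12 \/ u ^+ 2 - (2 * d + 1) * v ^+ 2 = -12 ->
  2 * e + 1 <= 29.
Proof.
move=> e0 d0 tE; have [k] := ubnP `|v|%N; elim: k u v => // k IH u v vk NE.
wlog u0 : u NE / 0 <= u => [W|].
  by case: (lerP 0 u) => [/W|?]; [exact | apply: (W (- u)); rewrite ?sqrrN //; lia].
wlog v0 : v vk NE / 0 <= v => [W|].
  by case: (lerP 0 v) => [/W|?]; [apply | apply: (W (- v)); rewrite ?sqrrN //; lia].
have [v_eq0|vn0] := eqVneq v 0.
  exfalso; rewrite v_eq0 !expr2 in NE; have : u <= 3 \/ 4 <= u by lia.
  case=> ?; last by nia.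
  have : u = 0 \/ u = 1 \/ u = 2 \/ u = 3 by lia.
  by case=> [|[|[|]]] uE; rewrite uE in NE; lia.
have v1 : 1 <= v ^+ 2 by rewrite -(expr1n _ 2) lerXn2r ?nnegrE //; lia.
(* One has 9(u^2 - D v^2) = 9u^2 - (t^2 - 4)v^2, and the left side is 108 or -108. If |3u - tv| >=
   2v, then v >= 1 forces e <= 14, that is t <= 29; the two cases below treat the two signs. *)
have [c1|c1] := lerP (3 * u) ((2 * e - 1) * v).
  have : (3 * u) ^+ 2 <= ((2 * e - 1) * v) ^+ 2.
    by rewrite lerXn2r ?nnegrE //; [lia | apply: le_trans c1; lia].
  have -> : ((2 * e - 1) * v) ^+ 2 = ((2 * e + 1) ^+ 2 - 8 * e) * v ^+ 2 by ring.
  rewrite tE; have [/(mulr_ege1 v1)|] : 1 <= e - 14 \/ e <= 14 by lia.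
    by case: NE; lia.
  by lia.
have [c2|c2] := lerP ((2 * e + 3) * v) (3 * u).
  have : ((2 * e + 3) * v) ^+ 2 <= (3 * u) ^+ 2.
    by rewrite lerXn2r ?nnegrE //; [apply: mulr_ge0; lia | lia].
  have -> : ((2 * e + 3) * v) ^+ 2 = ((2 * e + 1) ^+ 2 + 8 * e + 8) * v ^+ 2 by ring.
  rewrite tE; have [/(mulr_ege1 v1)|] : 1 <= e - 14 \/ e <= 14 by lia.
    by case: NE; lia.
  by lia.
(* As D is odd and the norm even, u and v have the same parity, which makes the halves below
   integral. *)
have [w wE] : exists w, u = v + 2 * w.
  have [a [r [aE r01]]] : exists a r, u = 2 * a + r /\ (r = 0 \/ r = 1).
    by exists (u %/ 2)%Z, (u %% 2)%Z; lia.
  have [b [z [bE z01]]] : exists b z, v = 2 * b + z /\ (z = 0 \/ z = 1).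
    by exists (v %/ 2)%Z, (v %% 2)%Z; lia.
  exists (a - b); subst u v.
  by case: r01 z01 NE => -> [] ->; lia.
(* These are v' = (tv - 3u)/2 and u' = (tu - 3Dv)/2, the coordinates of (u + v sqrt D)(t - 3 sqrt
   D)/2. The remaining range |3u - tv| < 2v is exactly |v'| < v. *)
pose v' := e * v - v - 3 * w.
pose u' := e * u - 3 * d * v - v + w.
apply: (IH u' v'); first by have : - v < v' < v; [rewrite /v'; lia | lia].
suff -> : u' ^+ 2 - (2 * d + 1) * v' ^+ 2 = u ^+ 2 - (2 * d + 1) * v ^+ 2 by [].
have : 4 * (u' ^+ 2 - (2 * d + 1) * v' ^+ 2) =
    ((2 * e + 1) ^+ 2 - 9 * (2 * d + 1)) * (u ^+ 2 - (2 * d + 1) * v ^+ 2).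
  by rewrite /u' /v' wE; ring.
by rewrite tE; lia.
Qed.

(** * Rational approximation and square-free integers *)

(** The fractional part of [b] is compared with 0, 1/4, 1/3, 1/2, 2/3, 3/4, 1; the cut points are
    chosen so that [n] times the distance to the selected fraction is at most 1/5. *)
Lemma dirichlet4 (b : rat) : exists n c : int,
  (n = 1 \/ n = 2 \/ n = 3 \/ n = 4) /\ `|n%:~R * b - c%:~R| <= 1 / 5.
Proof.
have /andP[] := floor_itv b; set f := Num.floor b; rewrite intrD => fb bf.
have [b1|b1] := lerP (b - f%:~R) (1 / 5).
  by exists 1, f; split; [lia | rewrite ler_norml; lra].
have [b2|b2] := lerP (b - f%:~R) (3 / 10).
  by exists 4, (4 * f + 1); split; [lia | rewrite (intrD _ (_ * _)) intrM ler_norml; lra].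
have [b3|b3] := lerP (b - f%:~R) (2 / 5).
  by exists 3, (3 * f + 1); split; [lia | rewrite (intrD _ (_ * _)) intrM ler_norml; lra].
have [b4|b4] := lerP (b - f%:~R) (3 / 5).
  by exists 2, (2 * f + 1); split; [lia | rewrite (intrD _ (_ * _)) intrM ler_norml; lra].
have [b5|b5] := lerP (b - f%:~R) (7 / 10).
  by exists 3, (3 * f + 2); split; [lia | rewrite (intrD _ (_ * _)) intrM ler_norml; lra].
have [b6|b6] := lerP (b - f%:~R) (4 / 5).
  by exists 4, (4 * f + 3); split; [lia | rewrite (intrD _ (_ * _)) intrM ler_norml; lra].
by exists 1, (f + 1); split; [lia | rewrite ler_norml intrD; lra].
Qed.

(** The squared denominator of [x] is coprime to the squared numerator, hence divides [D]. *)
Lemma sqfree_den (D : int) (x : rat) : squarefree_int D ->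
  D%:~R * x ^+ 2 \is a Num.int -> x \is a Num.int.
Proof.
move=> sqD /intrP[k kE]; rewrite Qint_def.
have dvd : (denq x ^+ 2 %| D)%Z.
  have /eqP : (numq x ^+ 2 * D)%:~R = (k * denq x ^+ 2)%:~R :> rat.
    rewrite (intrM _ _ D) (intrM _ k) -kE !rmorphXn /=.
    rewrite (_ : x ^+ 2 = (numq x)%:~R ^+ 2 / (denq x)%:~R ^+ 2);
      last by rewrite -expr_div_n divq_num_den.
    by field; rewrite intr_eq0 denq_neq0.
  rewrite eqr_int => /eqP E.
  rewrite -(@Gauss_dvdzr _ (numq x ^+ 2)); first by rewrite E dvdz_mull.
  by rewrite coprimezXl // coprimezXr // coprimez_sym coprimezE coprime_num_den.
by have := sqD _ dvd; have := denq_gt0 x; lia.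
Qed.

Lemma sqfree_nonsquare (D : int) (q : rat) : squarefree_int D -> D != 1 ->
  q ^+ 2 != D%:~R.
Proof.
move=> sqD D1; apply/eqP => qE.
have q0 : q != 0.
  apply/eqP => q0; have /eqP : D%:~R = 0 :> rat by rewrite -qE q0 expr0n.
  by rewrite intr_eq0 => /eqP D0; have := sqD 2; rewrite D0 dvdz0 => /(_ isT).
(* This product is 1, so 1/q is an integer n with D n^2 = 1, which leaves only D = 1. *)
have : D%:~R * q^-1 ^+ 2 \is a Num.int by rewrite -qE -exprMn mulfV // expr1n.
move/(sqfree_den sqD)/intrP => [n nE].
have /eqP : (D * n ^+ 2)%:~R = 1%:~R :> rat.
  by rewrite intrM rmorphXn /= -nE -qE -exprMn mulfV // expr1n.
rewrite eqr_int => /eqP Dn; move/negP: D1; apply; apply/eqP.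
have := sqr_ge0 n; move: (n ^+ 2) Dn => k Dn k0.
have [|[|]] : D <= 0 \/ 2 <= D \/ D = 1 by lia.
- by move=> D0; have := mulr_le0_ge0 D0 k0; lia.
- move=> D2; have := ler_wpM2r k0 D2; rewrite Dn => k_le.
  by move: Dn; (have -> : k = 0 by lia); rewrite mulr0.
- by [].
Qed.

(** * Coordinates, norm and integers of Q(sqrt D) *)

Section QuadraticField.
Variables (K : fieldExtType rat) (D : int) (s : K).
Hypothesis sqr_s : s ^+ 2 = D%:~R.
Hypothesis gen_s : <<1%VS; s>>%VS = fullv.
Hypothesis D_nonsquare : forall q : rat, q ^+ 2 != D%:~R.
Local Notation O := (ring_of_integers K).

Definition of_rat : {rmorphism rat -> K} := in_alg K.
Definition quad (p q : rat) : K := of_rat p + of_rat q * s.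
Definition quad_norm (p q : rat) : rat := p ^+ 2 - D%:~R * q ^+ 2.

Lemma quadD p q p' q' : quad p q + quad p' q' = quad (p + p') (q + q').
Proof. by rewrite /quad !rmorphD; ring. Qed.

Lemma quadB p q p' q' : quad p q - quad p' q' = quad (p - p') (q - q').
Proof. by rewrite /quad !rmorphB; ring. Qed.

Lemma quadM p q p' q' :
  quad p q * quad p' q' = quad (p * p' + D%:~R * q * q') (p * q' + q * p').
Proof.
rewrite /quad !rmorphD !rmorphM rmorph_int -sqr_s; ring.
Qed.

Lemma quad_normM p q p' q' :
  quad_norm (p * p' + D%:~R * q * q') (p * q' + q * p') =
  quad_norm p q * quad_norm p' q'.
Proof. by rewrite /quad_norm; ring. Qed.

Lemma quad_norm_eq0 p q : quad_norm p q = 0 -> p = 0 /\ q = 0.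
Proof.
rewrite /quad_norm => N0.
have q0 : q = 0.
  apply/eqP; apply: contraT => q0.
  suff: (p / q) ^+ 2 == D%:~R by rewrite (negPf (D_nonsquare _)).
  by rewrite expr_div_n (subr0_eq N0) mulfK // expf_eq0.
split=> //; move: N0; rewrite q0 expr0n mulr0 subr0 => /eqP.
by rewrite expf_eq0 => /eqP.
Qed.

Lemma quad_rat p : quad p 0 = of_rat p.
Proof. by rewrite /quad rmorph0 mul0r addr0. Qed.

Lemma quad_conjM p q : quad p q * quad p (- q) = of_rat (quad_norm p q).
Proof. by rewrite quadM -quad_rat /quad_norm; congr quad; ring. Qed.

Lemma quad_eq0 p q : quad p q = 0 -> p = 0 /\ q = 0.
Proof.
move=> x0; apply: quad_norm_eq0; have := quad_conjM p q.
by rewrite x0 mul0r => /esym/eqP; rewrite fmorph_eq0 => /eqP.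
Qed.

Lemma quad_inj p q p' q' : quad p q = quad p' q' -> p = p' /\ q = q'.
Proof.
move/eqP; rewrite -subr_eq0 quadB => /eqP/quad_eq0[].
by move=> /subr0_eq -> /subr0_eq ->.
Qed.

(** This replaces the Galois automorphism: conjugate arguments give conjugate values. It also shows
    that every polynomial in [s] has the form [quad u v]. *)
Lemma horner_quad (P : {poly rat}) p q : exists u v,
  (map_poly (of_rat) P).[quad p q] = quad u v /\
  (map_poly (of_rat) P).[quad p (- q)] = quad u (- v).
Proof.
elim/poly_ind: P => [|P c [u [v [E1 E2]]]].
  by exists 0, 0; rewrite rmorph0 !horner0 /quad oppr0 !rmorph0 mul0r addr0.
exists (u * p + D%:~R * v * q + c), (u * q + v * p).
rewrite rmorphD rmorphM /= map_polyX map_polyC /= !hornerE E1 E2 !quadM.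
have cE : c%:A = quad c 0 by rewrite quad_rat.
by rewrite cE !quadD; split; congr quad; ring.
Qed.

Lemma quad_surj x : exists p q, x = quad p q.
Proof.
have xs : x \in <<1%VS; s>>%VS by rewrite gen_s memvf.
have /polyOver1P[P PE] := Fadjoin_polyOver 1%VS s x.
have [u [v [E _]]] := horner_quad P 0 1.
exists u, v; rewrite -E -[LHS](Fadjoin_poly_eq xs) PE.
by rewrite /quad rmorph0 rmorph1 add0r mul1r.
Qed.

Lemma map_poly_intr (P : {poly int}) :
  map_poly intr P = map_poly of_rat (map_poly intr P).
Proof. by rewrite -map_poly_comp; apply: eq_map_poly => n; exact/esym/rmorph_int. Qed.

(** The monic equation is carried over to [algC], where rational algebraic integers are known to be
    integers. *)
Lemma ring_of_integers_rat (p : rat) : O (of_rat p) -> p \is a Num.int.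
Proof.
case=> P Pmon; rewrite map_poly_intr fmorph_root -Cint_rat.
rewrite -(fmorph_root (ratr : {rmorphism rat -> algC})) => Pp.
apply: Cint_rat_Aint; first exact: Crat_rat.
apply: root_monic_Aint Pp _ _; first by rewrite map_monic monic_map.
apply/polyOverP => i; rewrite !coef_map /= ratr_int; exact: intr_int.
Qed.

(** The two numbers are the trace and the norm. The conjugate of an integral element is a root of
    the same monic polynomial, so both are integral; conversely they are the coefficients t, n of
    X^2 - tX + n, which has [quad p q] as a root. *)
Lemma ring_of_integers_quadP p q :
  O (quad p q) <-> 2 * p \is a Num.int /\ quad_norm p q \is a Num.int.
Proof.
have TE : of_rat (2 * p) = quad p q + quad p (- q).
  by rewrite quadD -quad_rat; congr quad; ring.
split=> [Ox|[/intrP[t tE] /intrP[n nE]]].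
- have Ox' : O (quad p (- q)).
    case: Ox => P Pmon Px; exists P => //; move: Px; rewrite /root.
    rewrite map_poly_intr.
    have [u [v [-> ->]]] := horner_quad (map_poly intr P) p q.
    by move=> /eqP/quad_eq0[-> ->]; rewrite oppr0 /quad !rmorph0 mul0r addr0.
  split; apply: ring_of_integers_rat.
    by rewrite TE; apply: ring_of_integersD.
  by rewrite -quad_conjM; apply: ring_of_integersM.
- exists ('X^2 - t%:P * 'X + n%:P).
    rewrite -addrA monicE lead_coefDl ?lead_coefXn // size_polyXn.
    rewrite (leq_ltn_trans (size_polyD _ _)) // gtn_max size_polyN.
    rewrite mul_polyC (leq_ltn_trans (size_scale_leq _ _)) ?size_polyX //=.
    by rewrite (leq_ltn_trans (size_polyC_leq1 _)).
  rewrite /root rmorphD rmorphB !rmorphM /= map_polyX !map_polyC.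
  rewrite !hornerE /= -!(rmorph_int of_rat) -tE -nE -quad_conjM TE; apply/eqP; ring.
Qed.

Lemma ring_of_integers_conj p q : O (quad p q) -> O (quad p (- q)).
Proof.
by move=> /ring_of_integers_quadP[tr nm]; apply/ring_of_integers_quadP; rewrite /quad_norm sqrrN.
Qed.

(** * An element of norm 3 or -3 from a principal ideal above 3 *)

(** Let [a] generate the ideal (3, c) with c = r + sqrt D. Then N(a) divides both N(3) = 9 and N(c)
    = r^2 - D, and 3 divides N(a). As 9 does not divide N(c), N(a) is 3 or -3, and doubling the
    coordinates of [a] gives u and v. *)
Lemma norm_pm3_of_principal (r : int) : squarefree_int D ->
  (3 %| D - r ^+ 2)%Z -> ~~ (9 %| D - r ^+ 2)%Z ->
  (forall I : set K, fractional_ideal I -> exists2 a, a != 0 & I = principal_ideal a) ->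
  exists u v : int, u ^+ 2 - D * v ^+ 2 = 12 \/ u ^+ 2 - D * v ^+ 2 = -12.
Proof.
move=> sqD /dvdzP[k kE] D9 PI.
pose c := quad r%:~R 1.
have Oc : O c.
  apply/ring_of_integers_quadP; rewrite /quad_norm expr1n mulr1.
  by split; [rewrite -(intrM _ 2) | rewrite -rmorphXn -rmorphB]; apply: intr_int.
have O3 : O (quad 3 0) by rewrite quad_rat (rmorph_int of_rat 3); apply: ring_of_integersZ.
pose I : set K := fun z => exists x y, [/\ O x, O y & z = quad 3 0 * x + c * y].
have FI : fractional_ideal I.
  have O0 : O 0 := ring_of_integersZ K 0.
  split.
  - by exists 0, 0; split=> //; rewrite !mulr0 addr0.
  - move=> _ _ [x [y [Ox Oy ->]]] [x' [y' [Ox' Oy' ->]]].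
    exists (x + x'), (y + y'); split; [exact: ring_of_integersD.. | ring].
  - move=> a _ Oa [x [y [Ox Oy ->]]].
    exists (a * x), (a * y); split; [exact: ring_of_integersM.. | ring].
  - exists (quad 3 0).
      by exists 1, 0; split=> //; [exact: ring_of_integers1 | rewrite mulr1 mulr0 addr0].
    by apply/eqP => /quad_eq0[].
  - exists 1; split; [exact: ring_of_integers1 | exact: oner_neq0 |].
    move=> _ [x [y [Ox Oy ->]]]; rewrite mul1r.
    by apply: ring_of_integersD; apply: ring_of_integersM.
have [a _ IE] := PI I FI.
have [x [y [Ox Oy aE]]] : I a.
  by rewrite IE; exists 1; [exact: ring_of_integers1 | rewrite mulr1].
have [b Ob bE] : principal_ideal a (quad 3 0).
  rewrite -IE; exists 1, 0; split;
    [exact: ring_of_integers1 | exact: (ring_of_integersZ K 0) | ring].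
have [d Od dE] : principal_ideal a c.
  rewrite -IE; exists 0, 1; split;
    [exact: (ring_of_integersZ K 0) | exact: ring_of_integers1 | ring].
have Oa : O a by rewrite aE; apply: ring_of_integersD; apply: ring_of_integersM.
have [ap [aq aq_eq]] := quad_surj a; have [bp [bq bq_eq]] := quad_surj b.
have [dp [dq dq_eq]] := quad_surj d; have [xp [xq xq_eq]] := quad_surj x.
have [yp [yq yq_eq]] := quad_surj y; subst b d x y.
rewrite aq_eq in aE bE dE Oa; clear IE aq_eq.
have Nab : quad_norm ap aq * quad_norm bp bq = 9.
  by rewrite -quad_normM; move: bE; rewrite quadM => /quad_inj[-> ->]; rewrite /quad_norm; ring.
have Nad : quad_norm ap aq * quad_norm dp dq = r%:~R ^+ 2 - D%:~R.
  by rewrite -quad_normM; move: dE; rewrite quadM => /quad_inj[-> ->]; rewrite /quad_norm; ring.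
have /ring_of_integers_quadP[/intrP[u uE] /intrP[na naE]] := Oa.
have /ring_of_integers_quadP[_ /intrP[nb nbE]] := Ob.
have /ring_of_integers_quadP[_ /intrP[nd ndE]] := Od.
have /ring_of_integers_quadP[_ /intrP[nx nxE]] := Ox.
have /ring_of_integers_quadP[_ /intrP[ny nyE]] := Oy.
(* N(3x + cy) = 9 N(x) + 3 Tr(conj(x) c y) + N(c) N(y) is divisible by 3. *)
have [t tE] : exists t, na = 3 * t.
  have := ring_of_integersM (ring_of_integers_conj Ox) (ring_of_integersM Oc Oy).
  rewrite /c !quadM => /ring_of_integers_quadP[/intrP[T TE] _].
  exists (3 * nx + T - k * ny); apply/eqP; rewrite -(eqr_int rat) -naE.
  have kE' : D%:~R = k%:~R * 3 + r%:~R ^+ 2 :> rat.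
    by rewrite -[r%:~R ^+ 2]rmorphXn -(intrM _ k 3) -intrD; congr intr; lia.
  rewrite !(intrM, intrD, intrN) -nxE -TE -nyE /quad_norm.
  move: aE; rewrite /c !quadM quadD => /quad_inj[-> ->].
  by rewrite kE'; apply/eqP; ring.
have {}Nab : na * nb = 9.
  by apply/eqP; rewrite -(eqr_int rat) intrM -naE -nbE Nab.
have {}Nad : na * nd = r ^+ 2 - D.
  by apply/eqP; rewrite -(eqr_int rat) intrM -naE -ndE Nad intrD intrN rmorphXn.
have na3 : na = 3 \/ na = -3.
  have tnb : t * nb = 3 by move: Nab; rewrite tE; lia.
  have /dvdn_leq : (`|t| %| 3)%N by apply/dvdnP; exists `|nb|%N; lia.
  move=> /(_ isT) t3; have : t = 1 \/ t = -1 \/ t = 3 \/ t = -3.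
    have : t \in [:: -3; -2; -1; 0; 1; 2; 3] by rewrite !inE; lia.
    by rewrite !inE; case/or4P => [|||/or4P[]] /eqP tv; rewrite tv in tnb *; lia.
  case=> [|[|[|]]] tv; [lia | lia | exfalso..]; move/negP: D9; apply; apply/dvdzP.
    by exists (- nd); lia.
  by exists nd; lia.
(* Trace and norm give D (2 aq)^2 = u^2 - 4 N(a), an integer, so square-freeness of [D] clears the
   denominator. *)
have [v vE] : exists v : int, 2 * aq = v%:~R.
  apply/intrP/(sqfree_den sqD).
  rewrite (_ : D%:~R * _ = (u ^+ 2 - 4 * na)%:~R); first exact: intr_int.
  by rewrite rmorphB rmorphXn rmorphM /= -uE -naE /quad_norm; ring.
exists u, v.
suff -> : u ^+ 2 - D * v ^+ 2 = 4 * na by case: na3 => ->; [left | right].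
apply/eqP; rewrite -(eqr_int rat) rmorphB rmorphXn !rmorphM /= -uE -vE -naE.
by apply/eqP; rewrite /quad_norm; ring.
Qed.

(** * The Dedekind-Hasse criterion *)

Definition reducible (g : K) := exists x y u v,
  [/\ O x, O y, g * x - y = quad u v, quad_norm u v != 0
    & `|quad_norm u v| < 1].

(** Take a nonzero [a] in [I] with |N(da)| minimal, where the common denominator [d] makes these
    norms integers. If z/a were not integral for some [z] in [I], then xz - ya would be a nonzero
    element of [I] with a smaller value. *)
Lemma dedekind_hasse :
  (forall g, ~ O g -> reducible g) ->
  forall I : set K, fractional_ideal I -> exists2 a, a != 0 & I = principal_ideal a.
Proof.
move=> DH I [I0 ID IM [z0 Iz0 z0n0] [d [Od dn0 dI]]].
pose P n := exists z u v, [/\ I z, z != 0, d * z = quad u v & `|quad_norm u v| = n%:R].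
have PE z : I z -> z != 0 -> exists n, P n.
  move=> Iz zn0; have [u [v E]] := quad_surj (d * z).
  have := dI z Iz; rewrite E => /ring_of_integers_quadP[_ /intrP[n nE]].
  by exists `|n|%N, z, u, v; split=> //; rewrite nE -intr_norm -abszE.
have exP : exists n, `[< P n >] by have [n Pn] := PE _ Iz0 z0n0; exists n; apply/asboolP.
case: (ex_minnP exP) => n /asboolP[a [u0 [v0 [Ia an0 aE nE]]]] nmin.
exists a => //; apply/seteqP; split=> z; last first.
  by case=> x Ox <-; rewrite mulrC; apply: IM.
move=> Iz; have [Og|/DH[x [y [u [v [Ox Oy E N0 N1]]]]]] := pselect (O (z / a)).
  by exists (z / a); rewrite // mulrC divfK.
exfalso; pose c := x * z + (- y) * a.
have cE : c = a * quad u v by rewrite -E /c; field.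
have Ic : I c.
  apply: ID; apply: IM => //; rewrite -[- y]add0r.
  exact: ring_of_integersB (ring_of_integersZ K 0) Oy.
have cn0 : c != 0.
  rewrite cE mulf_neq0 //; apply/eqP => /quad_eq0[u0' v0'].
  by move: N0; rewrite u0' v0' /quad_norm !expr0n mulr0 subr0 eqxx.
have dcE : d * c = quad (u0 * u + D%:~R * v0 * v) (u0 * v + v0 * u).
  by rewrite cE mulrA aE quadM.
have := dI c Ic; rewrite dcE => /ring_of_integers_quadP[_ /intrP[k kE]].
have : `[< P `|k|%N >].
  apply/asboolP; exists c; eexists; eexists; split; [by []|by []|exact: dcE|].
  by rewrite kE -intr_norm -abszE.
move/nmin; rewrite -(ler_nat rat).
have -> : `|k|%N%:R = `|quad_norm u0 v0| * `|quad_norm u v| :> rat.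
  by rewrite -normrM -quad_normM kE -intr_norm -abszE.
rewrite nE.
have n0 : 0 < n%:R :> rat.
  rewrite -nE normr_gt0; apply/eqP => /quad_norm_eq0[u00 v00].
  have /eqP : d * a = 0 by rewrite aE u00 v00 /quad !rmorph0 mul0r addr0.
  by rewrite mulf_eq0 (negPf dn0) (negPf an0).
by rewrite leNgt gtr_pMr // N1.
Qed.

(** * The order Z[(1 + sqrt D)/2] and reduction of fractions with small denominators *)

Section Discriminant1Mod4.
Variable e : int.
Hypothesis D_mod4 : D = 4 * e + 1.
Hypothesis D_sqfree : squarefree_int D.

Let DE : D%:~R = 4 * e%:~R + 1 :> rat.
Proof. by rewrite D_mod4 intrD intrM. Qed.

(* [omega a b] is a + b (1 + s) / 2. *)
Definition omega (a b : rat) : K := quad (a + b / 2) (b / 2).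

Lemma norm_omega a b :
  quad_norm (a + b / 2) (b / 2) = a ^+ 2 + a * b - e%:~R * b ^+ 2.
Proof. by rewrite /quad_norm DE; field. Qed.

Lemma omegaM a b c d :
  omega a b * omega c d = omega (a * c + e%:~R * b * d) (a * d + b * c + b * d).
Proof. by rewrite /omega quadM DE; congr quad; field. Qed.

Lemma omegaB a b c d : omega a b - omega c d = omega (a - c) (b - d).
Proof. by rewrite /omega quadB; congr quad; ring. Qed.

Lemma ring_of_integers_omega (a b : int) : O (omega a%:~R b%:~R).
Proof.
apply/ring_of_integers_quadP; rewrite norm_omega; split.
  rewrite (_ : _ * _ = (2 * a + b)%:~R) ?intr_int //.
  by rewrite intrD intrM; field.
by rewrite -!rmorphXn -!rmorphM -rmorphD -rmorphB intr_int.
Qed.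

Lemma omega_surj x : exists a b, x = omega a b.
Proof.
have [p [q ->]] := quad_surj x; exists (p - q), (2 * q).
by rewrite /omega; congr quad; field.
Qed.

(** With trace t and norm n, D q^2 = t^2 - 4n makes q an integer b by square-freeness; since D is
    odd, t and b have equal parity, so (t - b)/2 is an integer. *)
Lemma ring_of_integers_omegaP x : O x -> exists a b : int, x = omega a%:~R b%:~R.
Proof.
have [p [q ->]] := omega_surj x.
move=> /ring_of_integers_quadP[/intrP[t tE] /intrP[n nE]].
have /intrP[b bE] : q \is a Num.int.
  apply: (sqfree_den D_sqfree); rewrite (_ : _ * _ = (t ^+ 2 - 4 * n)%:~R) ?intr_int //.
  by rewrite rmorphB rmorphXn rmorphM /= -nE -tE /quad_norm; field.
have N4 : t ^+ 2 - (4 * e + 1) * b ^+ 2 = 4 * n.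
  apply/eqP; rewrite -(eqr_int rat) -D_mod4 rmorphB rmorphXn !rmorphM /=.
  by rewrite -nE -tE -bE /quad_norm; apply/eqP; field.
have [a aE] : exists a, t = 2 * a + b.
  exists ((t - b) %/ 2)%Z; nia.
exists a, b; rewrite -bE; congr omega.
have -> : p = (t%:~R - q) / 2 by rewrite -tE; field.
by rewrite aE bE intrD intrM; field.
Qed.

Lemma reducible_mul (g z : K) : O z -> reducible (g * z) -> reducible g.
Proof.
move=> Oz [x [y [u [v [Ox Oy E N0 N1]]]]].
by exists (z * x), y, u, v; split=> //; [exact: ring_of_integersM | rewrite mulrA].
Qed.

(** Put h = b - c and let d round a + h/2. The norm is p^2 - D h^2/4 with p^2 <= 1/4 and 0 <= D
    h^2/4 < 1, so it lies strictly between -1 and 1. *)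
Lemma approx_omega (a b delta : rat) (c : int) :
  0 <= e -> `|b - c%:~R| <= delta -> D%:~R * delta ^+ 2 < 4 ->
  exists d : int, `|quad_norm (a - d%:~R + (b - c%:~R) / 2) ((b - c%:~R) / 2)| < 1.
Proof.
move=> e0 bc Dd; set h := b - c%:~R in bc *.
have [d] : exists d : int, `|a + h / 2 - d%:~R| <= 1 / 2.
  exists (Num.floor (a + h / 2 + 1 / 2)).
  have /andP[] := floor_itv (a + h / 2 + 1 / 2); rewrite intrD ler_norml; lra.
rewrite ler_norml => /andP[d1 d2]; exists d.
rewrite /quad_norm; set p := a - _ + _.
have p1 : -(1 / 2) <= p <= 1 / 2 by rewrite /p; lra.
have p2 : 0 <= p ^+ 2 <= 1 / 4 by rewrite sqr_ge0; nra.
have h2 : 0 <= D%:~R * h ^+ 2 < 4.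
  have D0 : 0 <= D%:~R :> rat by rewrite ler0z; lia.
  rewrite mulr_ge0 ?sqr_ge0 //=; apply: le_lt_trans Dd.
  by rewrite ler_wpM2l // -(real_normK (num_real h)) lerXn2r ?nnegrE // (le_trans _ bc).
rewrite (_ : D%:~R * _ = D%:~R * h ^+ 2 / 4); last by field.
by rewrite ltr_norml; lra.
Qed.

Lemma reducible_or_integral (g : K) (n : int) a b c delta :
  0 <= e -> g * n%:~R = omega a b ->
  `|b - c%:~R| <= delta -> D%:~R * delta ^+ 2 < 4 -> reducible g \/ O (g * n%:~R).
Proof.
move=> e0 gE bc Dd; have [d dP] := approx_omega a e0 bc Dd.
have E : g * n%:~R - omega d%:~R c%:~R = omega (a - d%:~R) (b - c%:~R).
  by rewrite gE omegaB.
have [N0|N0] := eqVneq (quad_norm (a - d%:~R + (b - c%:~R) / 2) ((b - c%:~R) / 2)) 0.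
  right; move: E; rewrite /omega; have [-> ->] := quad_norm_eq0 N0.
  rewrite {2}/quad !rmorph0 mul0r addr0 => /subr0_eq ->.
  exact: ring_of_integers_omega.
left; exists n%:~R, (omega d%:~R c%:~R); do 2!eexists; split; [| |exact: E| |] => //.
  exact: ring_of_integersZ.
exact: ring_of_integers_omega.
Qed.

(** Multiplication by the conjugate [omega (a + b) (- b)] turns the fraction into the rational F/n;
    subtracting its integer part leaves (F mod n)/n, strictly between 0 and 1. *)
Lemma reducible_div (n : int) (a b : int) : 0 < n ->
  ~~ (n %| a ^+ 2 + a * b - e * b ^+ 2)%Z ->
  reducible (omega (a%:~R / n%:~R) (b%:~R / n%:~R)).
Proof.
move=> n0; set F := a ^+ 2 + a * b - e * b ^+ 2 => nF.
have nr : n%:~R != 0 :> rat by rewrite intr_eq0 gt_eqF.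
pose r := (F %% n)%Z.
have n_neq0 : n != 0 by rewrite gt_eqF.
have r0 : 0 < r.
  rewrite lt_neqAle modz_ge0 // andbT eq_sym.
  by apply: contra nF => /eqP/dvdz_mod0P.
have rn : r < n by rewrite ltz_pmod.
exists (omega (a + b)%:~R (- b)%:~R), (omega (F %/ n)%Z%:~R 0).
exists (r%:~R / n%:~R + 0 / 2), (0 / 2); rewrite norm_omega.
rewrite expr0n !mulr0 subr0 !addr0.
have r01 : 0 < (r%:~R / n%:~R : rat) < 1.
  by rewrite divr_gt0 ?ltr0z //= ltr_pdivrMr ?ltr0z // mul1r ltr_int.
split.
- exact: ring_of_integers_omega.
- exact: (ring_of_integers_omega _ 0).
- rewrite omegaM omegaB [RHS](_ : _ = omega (r%:~R / n%:~R) 0); last first.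
    by rewrite /omega; congr quad; field.
  congr omega; last by rewrite intrN intrD; field.
  have -> : r%:~R = (F - (F %/ n)%Z * n)%:~R :> rat.
    by congr intr; rewrite {1}(divz_eq F n); ring.
  by rewrite /F !(intrD, intrN, intrM); field.
- by rewrite expf_eq0 /= gt_eqF //; lra.
- by rewrite ger0_norm ?sqr_ge0 // expr_lt1 //; lra.
Qed.

Lemma omega_divz (g : K) (n a b : int) : n != 0 -> g * n%:~R = omega a%:~R b%:~R ->
  g = omega (a%:~R / n%:~R) (b%:~R / n%:~R).
Proof.
move=> n0 gE; have nr : n%:~R != 0 :> rat by rewrite intr_eq0.
have nE : n%:~R = omega n%:~R 0 :> K.
  by rewrite /omega mul0r addr0 quad_rat (rmorph_int of_rat).
have nK : (n%:~R : K) != 0.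
  by rewrite -(rmorph_int of_rat) fmorph_eq0.
apply: (mulIf nK); rewrite gE nE omegaM; congr omega; by field.
Qed.

(** For odd e the norm form is a^2 + ab + b^2 modulo 2, which vanishes only when a and b are even: 2
    is inert. An even norm would thus make [g] integral. *)
Lemma reducible_half (g : K) : odd `|e|%N -> ~ O g -> O (g * 2) -> reducible g.
Proof.
move=> e_odd Og /ring_of_integers_omegaP[a [b abE]].
have gE := omega_divz (n := 2) isT abE.
have [F2|F2] := boolP (2 %| a ^+ 2 + a * b - e * b ^+ 2)%Z; last first.
  by rewrite gE; apply: reducible_div.
have [a' [b' [aE bE]]] : exists a' b', a = 2 * a' /\ b = 2 * b'.
  exists (a %/ 2)%Z, (b %/ 2)%Z; move/dvdzP: F2 => [k kE].
  have [i [r [aE r01]]] : exists i r, a = 2 * i + r /\ (r = 0 \/ r = 1).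
    by exists (a %/ 2)%Z, (a %% 2)%Z; lia.
  have [j [z [bE z01]]] : exists j z, b = 2 * j + z /\ (z = 0 \/ z = 1).
    by exists (b %/ 2)%Z, (b %% 2)%Z; lia.
  have [l lE] : exists l, e = 2 * l + 1 by exists (e %/ 2)%Z; lia.
  subst a b e; suff : r = 0 /\ z = 0 by lia.
  by case: r01 z01 kE => -> [] ->; lia.
case: Og; rewrite gE aE bE !intrM !(mulrC 2%:~R) !mulfK //.
exact: ring_of_integers_omega.
Qed.

Lemma reducible_quarter (g : K) : odd `|e|%N -> ~ O g -> O (g * 4) -> reducible g.
Proof.
move=> e_odd Og O4g; have [O2g|O2g] := pselect (O (g * 2)).
  exact: reducible_half.
apply: (reducible_mul (z := 2)); first exact: (ring_of_integersZ K 2).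
by apply: reducible_half => //; rewrite -mulrA -natrM.
Qed.

Lemma reducible_third (g : K) : e = 17 \/ e = 23 -> ~ O g -> O (g * 3) -> reducible g.
Proof.
move=> e_val Og /ring_of_integers_omegaP[a [b abE]].
have gE := omega_divz (n := 3) isT abE.
have [/dvdzP[k kE]|F3] := boolP (3 %| a ^+ 2 + a * b - e * b ^+ 2)%Z; last first.
  by rewrite gE; apply: reducible_div.
have [i [r [aE r012]]] : exists i r, a = 3 * i + r /\ (r = 0 \/ r = 1 \/ r = -1).
  by exists ((a + 1) %/ 3)%Z, (((a + 1)%R %% 3)%Z - 1); lia.
have [j [z [bE z012]]] : exists j z, b = 3 * j + z /\ (z = 0 \/ z = 1 \/ z = -1).
  by exists ((b + 1) %/ 3)%Z, (((b + 1)%R %% 3)%Z - 1); lia.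
(* Both values of e are -1 modulo 3, so the norm form is (a - b)^2 modulo 3. *)
have zE : z = r.
  subst a b; clear -e_val r012 z012 kE.
  by case: e_val kE => ->; case: r012 z012 => [|[|]] -> [|[|]] ->; lia.
have [r0|r0] := eqVneq r 0.
  case: Og; rewrite gE aE bE zE r0 !addr0 !(mulrC 3) !intrM !mulfK //.
  exact: ring_of_integers_omega.
have r2 : r%:~R ^+ 2 = 1 :> rat.
  by case: r012 r0 => [->|[|] ->] // _; rewrite ?rmorphN ?sqrrN expr1n.
have n_eq : (r%:~R * 4 / 3) ^+ 2 + r%:~R * 4 / 3 * (r%:~R / 3)
    - e%:~R * (r%:~R / 3) ^+ 2 = (20 - e%:~R) / 9 :> rat.
  transitivity (r%:~R ^+ 2 * (20 - e%:~R) / 9 : rat); first by field.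
  by rewrite r2 mul1r.
have nE : (20 - e%:~R) / 9 = 1 / 3 :> rat \/ (20 - e%:~R) / 9 = - (1 / 3) :> rat.
  by case: e_val => ->; [left | right]; lra.
(* Here 3 ramifies and [omega 4 1], of norm 20 - e = 3 or -3, generates the prime above
   it; up to sign and division by 3, it serves as the remainder. *)
exists 1, (omega (i - r)%:~R j%:~R); do 2!eexists; split.
- exact: ring_of_integers1.
- exact: ring_of_integers_omega.
- rewrite mulr1 gE omegaB (_ : _ - _ = r%:~R * 4 / 3); last first.
    by rewrite aE !(intrD, intrM, intrN); field.
  rewrite (_ : _ - _ = r%:~R / 3); last by rewrite bE zE !(intrD, intrM); field.
  by [].
- by rewrite norm_omega n_eq; case: nE => ->.
- by rewrite norm_omega n_eq; case: nE => ->; rewrite ltr_norml; lra.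
Qed.

End Discriminant1Mod4.

End QuadraticField.

(** * The three fields of class number one, and the equivalence *)

Lemma principal_13_69_93 (K : fieldExtType rat) (D e : int) (s : K) :
  s ^+ 2 = D%:~R -> <<1%VS; s>>%VS = fullv ->
  D = 4 * e + 1 -> squarefree_int D -> e = 3 \/ e = 17 \/ e = 23 ->
  forall I : set K, fractional_ideal I -> exists2 a, a != 0 & I = principal_ideal a.
Proof.
move=> sE gen_s De sqD e_val.
have D1 : D != 1 by rewrite De; lia.
have e0 : 0 <= e by lia.
have Dnsq q : q ^+ 2 != D%:~R :> rat by exact: sqfree_nonsquare.
apply: (dedekind_hasse sE gen_s Dnsq) => g Og.
have [a [b gE]] := omega_surj sE gen_s g.
have gnE (n : int) : g * n%:~R = omega s (a * n%:~R) (b * n%:~R).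
  by rewrite gE /omega -(rmorph_int (of_rat K)) -(quad_rat s) (quadM sE); congr quad; field.
have red_or_int n c delta := reducible_or_integral (c := c) (delta := delta) sE Dnsq De e0 (gnE n).
case: e_val => [e3|e_val].
(* For D = 13 rounding to the nearest integer is enough, as 13/4 < 4. *)
- have [] := red_or_int 1 (Num.floor (b + 1 / 2)) (1 / 2).
  + have /andP[] := floor_itv (b + 1 / 2); rewrite intrD mulr1 ler_norml; lra.
  + by rewrite De e3; lra.
  + by [].
  + by rewrite mulr1.
- have [n [c [n_val nb]]] := dirichlet4 b.
  (* The bound 1/5 works because 69 and 93 are below 100. *)
  have De5 : D%:~R * (1 / 5) ^+ 2 < 4 :> rat.
    by rewrite De; case: e_val => ->; lra.
  rewrite mulrC in nb; have [//|] := red_or_int n c _ nb De5.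
  have e_odd : odd `|e|%N by case: e_val => ->.
  case: n_val => [|[|[|]]] ->.
  + by rewrite mulr1.
  + exact: (reducible_half sE gen_s Dnsq De sqD e_odd Og).
  + exact: (reducible_third sE gen_s Dnsq De sqD e_val Og).
  + exact: (reducible_quarter sE gen_s Dnsq De sqD e_odd Og).
Qed.

Theorem theorem1p1 (m : int) (K : fieldExtType rat)
    (m_odd : odd `|m|%N)
    (m_mod3 : (m != 2 %[mod 3])%Z)
    (D_sqfree : squarefree_int (9 * m ^+ 2 + 4 * m))
    (K_def : is_quadratic_field K (9 * m ^+ 2 + 4 * m)) :
  class_number K = 1%N <-> m \in [:: -3; 1; 3].
Proof.
have [s sE gen_s] := K_def; rewrite class_number_eq1; split; last first.
  rewrite !inE => /or3P[] /eqP mE; move: (m) sE D_sqfree mE => ? sE D_sqfree mE; subst.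
  - by apply: (principal_13_69_93 (e := 17) sE gen_s) => //; right; left.
  - by apply: (principal_13_69_93 (e := 3) sE gen_s) => //; left.
  - by apply: (principal_13_69_93 (e := 23) sE gen_s) => //; right; right.
set D := 9 * m ^+ 2 + 4 * m in sE D_sqfree K_def *.
move=> PI.
have D1 : D != 1.
  rewrite (_ : D = m * (9 * m + 4)); last by rewrite /D; ring.
  apply/eqP => mD; have : (`|m| %| 1)%N by apply/dvdnP; exists `|(9 * m + 4)%R|%N; lia.
  rewrite dvdn1 => /eqP m1; have m_pm1 : m = 1 \/ m = -1 by lia.
  by case: m_pm1 mD => ->.
have Dnsq q : q ^+ 2 != D%:~R :> rat by exact: sqfree_nonsquare.
(* If 3 divides m, then r = 0 works because D is square-free. If m is 1 modulo 3, so is D, and D - 1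
   and D - 4 differ by 3, so 9 fails to divide one of them. *)
have [r r3 r9] : exists2 r, (3 %| D - r ^+ 2)%Z & ~~ (9 %| D - r ^+ 2)%Z.
  have m3 : (m %% 3)%Z = 0 \/ (m %% 3)%Z = 1 by lia.
  have mE := divz_eq m 3; set k := (m %/ 3)%Z in mE; case: m3 => m3; rewrite m3 in mE.
  - exists 0; rewrite expr0n subr0.
      by apply/dvdzP; exists (27 * k ^+ 2 + 4 * k); rewrite /D mE; ring.
    by apply/negP => D9; have := D_sqfree 3 D9.
  - have DE : D = 81 * k ^+ 2 + 66 * k + 13 by rewrite /D mE; ring.
    have [D9|D9] := boolP (9 %| D - 1 ^+ 2)%Z; last first.
      by exists 1 => //; apply/dvdzP; exists (27 * k ^+ 2 + 22 * k + 4); rewrite DE; ring.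
    exists 2; first by apply/dvdzP; exists (27 * k ^+ 2 + 22 * k + 3); rewrite DE; ring.
    by move/dvdzP: D9 => [j jE]; apply/negP => /dvdzP[i iE]; lia.
have [u [v uvE]] := norm_pm3_of_principal sE gen_s Dnsq D_sqfree r3 r9 PI.
have [d dE] : exists d, m = 2 * d + 1 by exists (m %/ 2)%Z; clear -m_odd; lia.
have DE : D = 2 * (18 * d ^+ 2 + 22 * d + 6) + 1 by rewrite /D dE; ring.
have d0 : 0 <= 18 * d ^+ 2 + 22 * d + 6.
  clear; have [d_ge0|d_lt0] := lerP 0 d; first by have := sqr_ge0 d; lia.
  rewrite (_ : _ + 6 = (d + 1) * (18 * d + 4) + 2); last by ring.
  by rewrite addr_ge0 ?mulr_le0 //; lia.
rewrite DE in uvE.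
(* The descent applies with t = |9m + 2|, as (9m + 2)^2 = 9D + 4; the sign of 9m + 2 decides whether
   e is 9d + 5 or -(9d + 6). *)
have m_small : `|9 * m + 2| <= 29.
  rewrite dE; clear -d0 uvE; have [d_ge0|d_lt0] : 0 <= 9 * d + 5 \/ 0 <= - (9 * d + 6) by lia.
    by have := pell_small_norm d_ge0 d0 _ uvE => /(_ ltac:(ring)); lia.
  by have := pell_small_norm d_lt0 d0 _ uvE => /(_ ltac:(ring)); lia.
(* The bound leaves the odd m from -3 to 3, and -1 is excluded since it is 2 modulo 3. *)
by rewrite !inE; clear -m_odd m_mod3 m_small; lia.
Qed.
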